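(* Let $R$ be a ring, $(\sigma,\delta)$ a quasi-derivation of $R$, $M_R$ a right $R$-module, and $n\geq 2$ an integer. Then: (1) $M_R$ is $(\sigma,\delta)$-skew McCoy if and only if $M[x]/M[x](x^n)$ is $(\overline{\sigma},\overline{\delta})$-skew McCoy (as a right $R[x]/(x^n)$-module). (2) $R$ is $(\sigma,\delta)$-skew McCoy if and only if $R[x]/(x^n)$ is $(\overline{\sigma},\overline{\delta})$-skew McCoy. (3) $R$ is McCoy if and only if $R[x]/(x^n)$ is McCoy.
   Context: Rings are associative with unity; modules are right modules. A quasi-derivation $(\sigma,\delta)$ of a ring $R$ consists of a ring endomorphism $\sigma$ of $R$ and an additive map $\delta\colon R\to R$ with $\delta(ab)=\sigma(a)\delta(b)+\delta(a)b$ for all $a,b\in R$. The Ore extension $R[y;\sigma,\delta]$ consists of polynomials $\sum a_iy^i$ with coefficients on the left and multiplication determined by $ya=\sigma(a)y+\delta(a)$. For $0\le i\le j$, $f_i^j\colon R\to R$ is the sum of all words in $\sigma,\delta$ with $i$ factors $\sigma$ and $j-i$ factors $\delta$, so $y^ja=\sum_{i=0}^jf_i^j(a)y^i$. For a right $R$-module $M$, $M[y;\sigma,\delta]=\{\sum_{i=0}^p m_iy^i\mid p\ge0,\ m_i\in M\}$ is the right $R[y;\sigma,\delta]$-module with obvious addition and action $(my^j)(ay^{\ell})=\sum_{i=0}^jmf_i^j(a)y^{i+\ell}$. $M_R$ is called $(\sigma,\delta)$-skew McCoy if whenever $m(y)g(y)=0$ with $m(y)\in M[y;\sigma,\delta]$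 and $g(y)\in R[y;\sigma,\delta]\setminus\{0\}$, there exists $a\in R\setminus\{0\}$ with $m(y)a=0$. A ring is $(\sigma,\delta)$-skew McCoy if it is so as a right module over itself. A ring or module is McCoy if it is $(\mathrm{id},0)$-skew McCoy. $R[x]$ and $M[x]$ are the ordinary polynomial ring and module ($x$ commutes with elements of $R$); $(x^n)$ is the ideal of $R[x]$ generated by $x^n$, and $M[x](x^n)$ is the submodule of $M[x]$ generated by $x^n$, i.e. the set of elements all of whose coefficients in degree $<n$ vanish. The quotient $M[x]/M[x](x^n)$ is a right $R[x]/(x^n)$-module. The quasi-derivation $(\overline{\sigma},\overline{\delta})$ of $R[x]/(x^n)$ is induced by applying $\sigma$, respectively $\delta$, to each coefficient. *)

(* Defs.v *)
From HB Require Import structures.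
From mathcomp Require Import all_boot all_algebra finmap.
From mathcomp Require Import monalg.

Set Implicit Arguments.
Unset Strict Implicit.
Unset Printing Implicit Defensive.

Import GRing.Theory.
Local Open Scope ring_scope.
Local Open Scope quotient_scope.

(* A right R-module is a left module over the converse ring R^c.  The regular *)
(* right module R_R is (R^c)^o.  Rings are pzRingTypes: the zero ring is      *)
(* allowed, which rules out {poly R} (it requires 1 != 0); polynomials over a *)
(* ring or a module are finitely supported sequences {malg _[nat]}.           *)
Definition ract (R : pzRingType) (M : lmodType R^c) (m : M) (a : R) : M :=
  (a : R^c) *: m.

Record quasi_derivation (R : pzRingType) := QuasiDerivation {
  qd_sigma : {rmorphism R -> R};
  qd_delta : {additive R -> R};
  qd_deltaM : forall a b : R,
    qd_delta (a * b) = qd_sigma a * qd_delta b + qd_delta a * b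
}.

Lemma qd_id_subproof (R : pzRingType) (a b : R) :
  (\0 : {additive R -> R}) (a * b)
  = (idfun : {rmorphism R -> R}) a * (\0 : {additive R -> R}) b
    + (\0 : {additive R -> R}) a * b.
Proof. by rewrite /= mulr0 mul0r addr0. Qed.

Definition qd_id (R : pzRingType) : quasi_derivation R :=
  QuasiDerivation (@qd_id_subproof R).

(* f_i^j: a word of length j is a j-tuple of booleans, true standing for      *)
(* sigma and false for delta.                                                 *)
Definition qd_f (R : pzRingType) (qd : quasi_derivation R) (i j : nat) (a : R)
    : R :=
  \sum_(w : j.-tuple bool | count id w == i)
    foldr (fun (s : bool) b => if s then qd_sigma qd b else qd_delta qd b) a w.

(* The action of R[y; sigma, delta] on M[y; sigma, delta].  Only the          *)
(* underlying sets of these two objects and this action enter the definition  *)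
(* of skew McCoy modules.                                                     *)
Definition ore_act (R : pzRingType) (qd : quasi_derivation R)
    (M : lmodType R^c) (m : {malg M[nat]}) (g : {malg R[nat]}) :
    {malg M[nat]} :=
  \sum_(j <- msupp m) \sum_(l <- msupp g) \sum_(i < j.+1)
    << ract m@_j (qd_f qd i j g@_l) *g (i + l)%N >>.

Definition skew_mccoy (R : pzRingType) (qd : quasi_derivation R)
    (M : lmodType R^c) : Prop :=
  forall (m : {malg M[nat]}) (g : {malg R[nat]}),
    g != 0 -> ore_act qd m g = 0 ->
    exists2 a : R, a != 0 & ore_act qd m << a *g 0%N >> = 0.

Definition skew_mccoy_ring (R : pzRingType) (qd : quasi_derivation R) : Prop :=
  @skew_mccoy R qd ((R^c)^o : lmodType R^c).

Definition mccoy_ring (R : pzRingType) : Prop := skew_mccoy_ring (qd_id R).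

Section Convolution.
Variables (G1 G2 G3 : zmodType) (op : G1 -> G2 -> G3).

Definition conv (p : {malg G1[nat]}) (q : {malg G2[nat]}) : {malg G3[nat]} :=
  \sum_(i <- msupp p) \sum_(j <- msupp q) << op p@_i q@_j *g (i + j)%N >>.

Hypothesis op0x : forall b, op 0 b = 0.
Hypothesis opx0 : forall a, op a 0 = 0.

Lemma conv_coef p q k :
  (conv p q)@_k = \sum_(0 <= i < k.+1) op p@_i q@_(k - i)%N.
Proof.
rewrite /conv raddf_sum /=.
transitivity (\sum_(i <- msupp p | (i < k.+1)%N) op p@_i q@_(k - i)%N).
  rewrite [RHS]big_mkcond /=; apply: eq_bigr => i _.
  rewrite raddf_sum /= ltnS; case: leqP => [le_ik|lt_ki].
    transitivity (\sum_(j <- msupp q) op p@_i q@_j *+ (j == k - i)%N).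
      apply: eq_bigr => j _; rewrite mcoeffU; congr (_ *+ _).
      by rewrite -{1}(subnKC le_ik) eqn_add2l.
    case: (boolP ((k - i)%N \in msupp q)) => [kq|kNq].
      rewrite (big_fsetD1 _ kq) /= eqxx mulr1n big1_fset ?addr0 // => j.
      by rewrite in_fsetD1 => /andP[/negPf->].
    rewrite (mcoeff_outdom kNq) opx0 big1_fset // => j jq _.
    by case: eqP => // ejk; rewrite -ejk jq in kNq.
  rewrite big1 // => j _; rewrite mcoeffU.
  by rewrite gtn_eqF // (leq_trans lt_ki) ?leq_addr.
rewrite -[LHS]big_filter [RHS](bigID (fun i => i \in msupp p)) /=.
rewrite [X in _ + X]big1 => [|i /mcoeff_outdom->]; last exact: op0x.
rewrite addr0 -[RHS]big_filter; apply: perm_big; apply: uniq_perm.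
- by rewrite filter_uniq ?fset_uniq.
- by rewrite filter_uniq ?iota_uniq.
by move=> i; rewrite !mem_filter mem_index_iota andbC.
Qed.

End Convolution.


Section RightAction.
Variables (R : pzRingType) (M : lmodType R^c).
Implicit Types (m : M) (a b : R).

Lemma ract0m a : ract (0 : M) a = 0. Proof. exact: scaler0. Qed.
Lemma ractm0 m : ract m 0 = 0. Proof. exact: scale0r. Qed.
Lemma ractm1 m : ract m 1 = m. Proof. exact: scale1r. Qed.
Lemma ractDl m m' a : ract (m + m') a = ract m a + ract m' a.
Proof. exact: scalerDr. Qed.
Lemma ractDr m a b : ract m (a + b) = ract m a + ract m b.
Proof. exact: scalerDl. Qed.
Lemma ractM m a b : ract (ract m a) b = ract m (a * b).
Proof. exact: scalerA. Qed.

Lemma ract_suml I (r : seq I) P (F : I -> M) a :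
  ract (\sum_(i <- r | P i) F i) a = \sum_(i <- r | P i) ract (F i) a.
Proof. exact: scaler_sumr. Qed.
Lemma ract_sumr I (r : seq I) P (F : I -> R) m :
  ract m (\sum_(i <- r | P i) F i) = \sum_(i <- r | P i) ract m (F i).
Proof. exact: scaler_suml. Qed.

End RightAction.

(* R[x] and its action on M[x]. *)
Definition px_mul (R : pzRingType) (p q : {malg R[nat]}) : {malg R[nat]} :=
  conv *%R p q.

Definition px_act (R : pzRingType) (M : lmodType R^c)
    (m : {malg M[nat]}) (p : {malg R[nat]}) : {malg M[nat]} :=
  conv (@ract R M) m p.

Section PolyAxioms.
Variables (R : pzRingType) (M : lmodType R^c).
Implicit Types (m : {malg M[nat]}) (p q r : {malg R[nat]}).

Lemma px_mul_coef p q k :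
  (px_mul p q)@_k = \sum_(0 <= i < k.+1) p@_i * q@_(k - i)%N.
Proof. by rewrite conv_coef // => a; rewrite ?mul0r ?mulr0. Qed.

Lemma px_act_coef m p k :
  (px_act m p)@_k = \sum_(0 <= i < k.+1) ract m@_i p@_(k - i)%N.
Proof. by rewrite conv_coef // => a; rewrite ?ract0m ?ractm0. Qed.

Lemma px_actA m p q : px_act (px_act m p) q = px_act m (px_mul p q).
Proof.
apply/malgP => k; rewrite !px_act_coef.
pose F i j := ract m@_j (p@_(i - j)%N * q@_(k - i)%N).
transitivity (\sum_(i < k.+1) \sum_(j < k.+1 | (j <= i)%N) F i j).
  rewrite big_mkord; apply: eq_bigr => i _.
  rewrite px_act_coef ract_suml big_mkord.
  rewrite (big_ord_widen k.+1 (fun j : nat =>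
    ract (ract m@_j p@_(i - j)%N) q@_(k - i)%N)) //=.
  by apply: eq_bigr => j _; rewrite ractM.
rewrite (exchange_big_dep predT) //= big_mkord; apply: eq_bigr => j _.
rewrite px_mul_coef ract_sumr big_mkord.
rewrite (reindex_inj rev_ord_inj) /=.
rewrite (eq_bigl (fun i : 'I_k.+1 => i < (k - j).+1)%N); last first.
  by move=> i; rewrite subSS ltnS leq_subCr // ?leq_ord.
rewrite [RHS](reindex_inj rev_ord_inj) /=.
rewrite (big_ord_widen k.+1 (fun i : nat =>
    ract m@_(j : nat) (p@_((k - j).+1 - i.+1)%N * q@_(k - j - ((k - j).+1 - i.+1))%N)));
  last by rewrite ltnS leq_subr.
apply: eq_bigr => i le_i; rewrite /F !subSS subKn ?leq_ord //.
by rewrite subKn // subnAC.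
Qed.

Lemma px_actDl m m' p : px_act (m + m') p = px_act m p + px_act m' p.
Proof.
apply/malgP => k; rewrite mcoeffD !px_act_coef -big_split.
by apply: eq_bigr => i _; rewrite mcoeffD ractDl.
Qed.

Lemma px_actDr m p q : px_act m (p + q) = px_act m p + px_act m q.
Proof.
apply/malgP => k; rewrite mcoeffD !px_act_coef -big_split.
by apply: eq_bigr => i _; rewrite mcoeffD ractDr.
Qed.

Lemma px_actXn m n k :
  (px_act m << 1 *g n >>)@_k = if (n <= k)%N then m@_(k - n)%N else 0.
Proof.
rewrite px_act_coef big_mkord; case: leqP => [le_nk|lt_kn].
  have lt_i : (k - n < k.+1)%N by rewrite ltnS leq_subr.
  rewrite (bigD1 (Ordinal lt_i)) //= subKn // mcoeffUU ractm1.
  rewrite big1 ?addr0 // => i; rewrite -val_eqE /= => Ni.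
  rewrite mcoeffU (_ : (n == k - i)%N = false) ?ractm0 //.
  apply: contraNF Ni => /eqP->; rewrite subKn ?leq_ord //.
rewrite big1 // => i _; rewrite mcoeffU gtn_eqF ?ractm0 //.
by rewrite (leq_ltn_trans (leq_subr _ _)).
Qed.

Lemma px_act1 m : px_act m << 1 *g 0%N >> = m.
Proof. by apply/malgP => k; rewrite px_actXn leq0n subn0. Qed.

End PolyAxioms.

Definition polyx (R : pzRingType) : Type := {malg R[nat]}.

Section PolyRing.
Variable R : pzRingType.
Implicit Types p q r : {malg R[nat]}.

Lemma px_mulA : associative (@px_mul R).
Proof. by move=> p q r; apply/esym/(@px_actA R (R^c)^o). Qed.
Lemma px_mulDl : left_distributive (@px_mul R) +%R.
Proof. by move=> p q r; apply: (@px_actDl R (R^c)^o). Qed.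
Lemma px_mulDr : right_distributive (@px_mul R) +%R.
Proof. by move=> p q r; apply: (@px_actDr R (R^c)^o). Qed.
Lemma px_mulp1 : right_id << 1 *g 0%N >> (@px_mul R).
Proof. by move=> p; apply: (@px_act1 R (R^c)^o). Qed.

Lemma px_mulXn n p : px_mul << 1 *g n >> p = px_mul p << 1 *g n >>.
Proof.
apply/malgP => k; rewrite !px_mul_coef.
rewrite big_nat_rev /= add0n; apply: eq_big_nat => i /andP[_ lt_i].
rewrite !subSS subKn // !mcoeffU.
by case: (n == _)%N; rewrite ?mulr1n ?mulr0n ?mulr0 ?mul0r ?mulr1 ?mul1r.
Qed.

Lemma px_mul1p : left_id << 1 *g 0%N >> (@px_mul R).
Proof. by move=> p; rewrite px_mulXn px_mulp1. Qed.

HB.instance Definition _ := GRing.Zmodule.on (polyx R).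
HB.instance Definition _ := GRing.Zmodule_isPzRing.Build (polyx R)
  px_mulA px_mul1p px_mulp1 px_mulDl px_mulDr.

End PolyRing.

Definition polyxM (R : pzRingType) (M : lmodType R^c) : Type := {malg M[nat]}.

Section PolyModule.
Variables (R : pzRingType) (M : lmodType R^c).

Definition polyxM_scale (p : (polyx R)^c) (m : polyxM M) : polyxM M :=
  px_act m (p : polyx R).

Lemma polyxM_scaleA (p q : (polyx R)^c) (m : polyxM M) :
  polyxM_scale p (polyxM_scale q m) = polyxM_scale (p * q) m.
Proof. exact: px_actA. Qed.
Lemma polyxM_scale1 : left_id 1 polyxM_scale.
Proof. exact: px_act1. Qed.

HB.instance Definition _ := GRing.Zmodule.on (polyxM M).

Lemma polyxM_scaleDr : right_distributive polyxM_scale +%R.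
Proof. by move=> p m m'; apply: px_actDl. Qed.
Lemma polyxM_scaleDl (m : polyxM M) :
  {morph polyxM_scale^~ m : p q / p + q}.
Proof. by move=> p q; apply: px_actDr. Qed.

HB.instance Definition _ := GRing.Zmodule_isLmodule.Build (polyx R)^c (polyxM M)
  polyxM_scaleA polyxM_scale1 polyxM_scaleDr polyxM_scaleDl.

End PolyModule.

Definition px_X (R : pzRingType) : polyx R := << 1 *g 1%N >>.

Lemma px_XnE (R : pzRingType) n : px_X R ^+ n = << 1 *g n >>.
Proof.
elim: n => [//|n IHn]; rewrite exprS IHn; apply/malgP => k.
rewrite (@px_actXn R (R^c)^o) !mcoeffU; case: k => [|k].
  by rewrite leqn0; case: n {IHn}.
case: leqP => [le_nk|lt_kn].
  by rewrite -(eqn_add2r n) subnK // add1n.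
by rewrite eqSS gtn_eqF // ltnW.
Qed.

(* The coefficient description of M[x](x^n), and of the ideal (x^n) of R[x].  *)
(* xn_pred_modP and xn_predXP identify these with the sets of multiples of    *)
(* x^n, and x^n is central by px_Xn_central.                                  *)
Definition xn_pred (G : zmodType) (n : nat) (p : {malg G[nat]}) : bool :=
  [forall i : 'I_n, p@_(i : nat) == 0].

Lemma xn_predP (G : zmodType) n (p : {malg G[nat]}) :
  reflect (forall i, (i < n)%N -> p@_i = 0) (xn_pred n p).
Proof.
apply: (iffP forallP) => [p0 i lt_in|p0 i]; last by rewrite p0.
exact/eqP/(p0 (Ordinal lt_in)).
Qed.

Lemma xn_pred_zmod (G : zmodType) n : zmod_closed (@xn_pred G n).
Proof.
split=> [|p q /xn_predP p0 /xn_predP q0]; apply/xn_predP => i lt_in.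
  by rewrite mcoeff0.
by rewrite mcoeffB p0 // q0 // subr0.
Qed.

HB.instance Definition _ (G : zmodType) n :=
  GRing.isZmodClosed.Build {malg G[nat]} (@xn_pred G n) (xn_pred_zmod G n).

Definition xn_sub (G : zmodType) n : zmodClosed {malg G[nat]} :=
  GRing.ZmodClosed.clone _ (@xn_pred G n) _.


Lemma xn_pred_modP (R : pzRingType) (M : lmodType R^c) n (m : polyxM M) :
  reflect (exists m' : polyxM M, m = ract m' (px_X R ^+ n)) (xn_pred n m).
Proof.
rewrite px_XnE; apply: (iffP (xn_predP _ _)) => [m0|[m' ->] i lt_in]; last first.
  by rewrite px_actXn leqNgt lt_in.
pose c k : M := mcoeff (k + n)%N (m : {malg M[nat]}).
exists [malg k in [fset (i - n)%N | i in msupp m]%fset => c k].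
apply/malgP => k; rewrite px_actXn; case: leqP => [le_nk|/m0//].
rewrite mcoeffE /c subnK //; case: ifP => // /negP kN.
apply: mcoeff_outdom; apply/negP => km; apply: kN.
by apply/imfsetP; exists k.
Qed.

Lemma xn_predXP (R : pzRingType) n (p : polyx R) :
  reflect (exists q : polyx R, p = q * px_X R ^+ n) (xn_pred n p).
Proof. exact: (@xn_pred_modP R (R^c)^o n p). Qed.

Lemma px_Xn_central (R : pzRingType) n (p : polyx R) :
  px_X R ^+ n * p = p * px_X R ^+ n.
Proof. by rewrite px_XnE; apply: px_mulXn. Qed.

Lemma xn_pred_act (R : pzRingType) (M : lmodType R^c) n (m m' : polyxM M)
    (p p' : polyx R) :
  xn_pred n (m - m') -> xn_pred n (p - p') ->
  xn_pred n (ract m p - ract m' p').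
Proof.
move=> /xn_predP m0 /xn_predP p0; apply/xn_predP => i lt_in.
rewrite mcoeffB !px_act_coef -sumrB big_mkord big1 // => j _.
have /eqP : (m : {malg M[nat]})@_(j : nat) - m'@_(j : nat) = 0.
  by rewrite -mcoeffB m0 // (leq_ltn_trans _ lt_in) // -ltnS.
have /eqP : (p : {malg R[nat]})@_(i - j)%N - p'@_(i - j)%N = 0.
  by rewrite -mcoeffB p0 // (leq_ltn_trans (leq_subr _ _)).
by rewrite !subr_eq0 => /eqP-> /eqP->; rewrite subrr.
Qed.

Lemma xn_pred_mul (R : pzRingType) n (p p' q q' : polyx R) :
  xn_pred n (p - p') -> xn_pred n (q - q') -> xn_pred n (p * q - p' * q').
Proof. exact: (@xn_pred_act R (R^c)^o n p p' q q'). Qed.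

Section Quotients.
Variables (R : pzRingType) (M : lmodType R^c) (n : nat).

Definition polyx_quot : Type := Quotient.quot (xn_sub R n).
Definition polyxM_quot : Type := Quotient.quot (xn_sub M n).

HB.instance Definition _ := GRing.Zmodule.on polyx_quot.
HB.instance Definition _ := GRing.Zmodule.on polyxM_quot.

Definition polyx_pi (p : polyx R) : polyx_quot :=
  \pi_(Quotient.quot (xn_sub R n)) p.
Definition polyx_repr (u : polyx_quot) : polyx R :=
  repr (u : Quotient.quot (xn_sub R n)).
Definition polyxM_pi (m : polyxM M) : polyxM_quot :=
  \pi_(Quotient.quot (xn_sub M n)) m.
Definition polyxM_repr (v : polyxM_quot) : polyxM M :=
  repr (v : Quotient.quot (xn_sub M n)).

Lemma polyx_reprK : cancel polyx_repr polyx_pi. Proof. exact: reprK. Qed.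
Lemma polyxM_reprK : cancel polyxM_repr polyxM_pi. Proof. exact: reprK. Qed.

Lemma polyx_piP (p q : polyx R) :
  reflect (polyx_pi p = polyx_pi q) (xn_pred n (p - q)).
Proof.
rewrite [xn_pred n _](@Quotient.idealrBE _ (xn_sub R n) p q); exact: eqP.
Qed.
Lemma polyxM_piP (m m' : polyxM M) :
  reflect (polyxM_pi m = polyxM_pi m') (xn_pred n (m - m')).
Proof.
rewrite [xn_pred n _](@Quotient.idealrBE _ (xn_sub M n) m m'); exact: eqP.
Qed.

Lemma polyx_piD (p q : polyx R) : polyx_pi (p + q) = polyx_pi p + polyx_pi q.
Proof. exact: (Quotient.pi_add (xn_sub R n)). Qed.
Lemma polyxM_piD (m m' : polyxM M) :
  polyxM_pi (m + m') = polyxM_pi m + polyxM_pi m'.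
Proof. exact: (Quotient.pi_add (xn_sub M n)). Qed.

Definition polyx_quot_one : polyx_quot := polyx_pi 1.
Definition polyx_quot_mul (u v : polyx_quot) : polyx_quot :=
  polyx_pi (polyx_repr u * polyx_repr v).
Definition polyxM_quot_scale (u : polyx_quot) (v : polyxM_quot) : polyxM_quot :=
  polyxM_pi (ract (polyxM_repr v) (polyx_repr u)).

Lemma polyx_piB (p q : polyx R) : polyx_pi (p - q) = polyx_pi p - polyx_pi q.
Proof. by apply/esym/eqP; rewrite subr_eq -polyx_piD subrK. Qed.

Lemma polyx_quot_piM (p q : polyx R) :
  polyx_quot_mul (polyx_pi p) (polyx_pi q) = polyx_pi (p * q).
Proof.
by apply/polyx_piP/xn_pred_mul; apply/polyx_piP; rewrite polyx_reprK.
Qed.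
Lemma polyxM_quot_piZ (p : polyx R) (m : polyxM M) :
  polyxM_quot_scale (polyx_pi p) (polyxM_pi m) = polyxM_pi (ract m p).
Proof.
apply/polyxM_piP/xn_pred_act; first by apply/polyxM_piP; rewrite polyxM_reprK.
by apply/polyx_piP; rewrite polyx_reprK.
Qed.

Lemma polyx_quot_mulA : associative polyx_quot_mul.
Proof.
move=> u v w; rewrite -[u]polyx_reprK -[v]polyx_reprK -[w]polyx_reprK.
by rewrite !polyx_quot_piM mulrA.
Qed.
Lemma polyx_quot_mul1 : left_id polyx_quot_one polyx_quot_mul.
Proof. by move=> u; rewrite -[u]polyx_reprK polyx_quot_piM mul1r. Qed.
Lemma polyx_quot_mulr1 : right_id polyx_quot_one polyx_quot_mul.
Proof. by move=> u; rewrite -[u]polyx_reprK polyx_quot_piM mulr1. Qed.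
Lemma polyx_quot_mulDl : left_distributive polyx_quot_mul +%R.
Proof.
move=> u v w; rewrite -[u]polyx_reprK -[v]polyx_reprK -[w]polyx_reprK.
by rewrite -polyx_piD !polyx_quot_piM mulrDl polyx_piD.
Qed.
Lemma polyx_quot_mulDr : right_distributive polyx_quot_mul +%R.
Proof.
move=> u v w; rewrite -[u]polyx_reprK -[v]polyx_reprK -[w]polyx_reprK.
by rewrite -polyx_piD !polyx_quot_piM mulrDr polyx_piD.
Qed.

HB.instance Definition _ := GRing.Zmodule_isPzRing.Build polyx_quot
  polyx_quot_mulA polyx_quot_mul1 polyx_quot_mulr1
  polyx_quot_mulDl polyx_quot_mulDr.

Lemma polyx_piM (p q : polyx R) : polyx_pi (p * q) = polyx_pi p * polyx_pi q.
Proof. by rewrite -polyx_quot_piM. Qed.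

Lemma polyxM_quot_scaleA (u v : polyx_quot^c) w :
  polyxM_quot_scale u (polyxM_quot_scale v w) = polyxM_quot_scale (u * v) w.
Proof.
rewrite [_ * _](_ : _ = polyx_quot_mul v u) //.
rewrite -[u]polyx_reprK -[v]polyx_reprK -[w]polyxM_reprK.
by rewrite polyx_quot_piM !polyxM_quot_piZ ractM.
Qed.
Lemma polyxM_quot_scale1 :
  left_id (1 : polyx_quot^c) polyxM_quot_scale.
Proof. by move=> w; rewrite -[w]polyxM_reprK polyxM_quot_piZ ractm1. Qed.
Lemma polyxM_quot_scaleDr :
  right_distributive (polyxM_quot_scale : polyx_quot^c -> _) +%R.
Proof.
move=> u v w; rewrite -[u]polyx_reprK -[v]polyxM_reprK -[w]polyxM_reprK.
by rewrite -polyxM_piD !polyxM_quot_piZ ractDl polyxM_piD.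
Qed.
Lemma polyxM_quot_scaleDl (w : polyxM_quot) :
  {morph (polyxM_quot_scale : polyx_quot^c -> _)^~ w : u v / u + v}.
Proof.
move=> u v; rewrite -[u]polyx_reprK -[v]polyx_reprK -[w]polyxM_reprK.
rewrite [X in polyxM_quot_scale X _](_ : _ =
  polyx_pi (polyx_repr u + polyx_repr v)); last by rewrite polyx_piD.
by rewrite !polyxM_quot_piZ ractDr polyxM_piD.
Qed.

HB.instance Definition _ := GRing.Zmodule_isLmodule.Build polyx_quot^c
  polyxM_quot polyxM_quot_scaleA polyxM_quot_scale1
  polyxM_quot_scaleDr polyxM_quot_scaleDl.

End Quotients.

Section CoefficientMaps.
Variables (R : pzRingType) (n : nat).

Definition map_coef (f : R -> R) (p : polyx R) : polyx R :=
  [malg k in msupp p => f (mcoeff k (p : {malg R[nat]}))].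

(* Independent of the chosen representative when f is additive: quot_map_pi.  *)
Definition quot_map (f : R -> R) (u : polyx_quot R n) : polyx_quot R n :=
  polyx_pi n (map_coef f (polyx_repr u)).

Lemma map_coefE (f : {additive R -> R}) (p : polyx R) k :
  mcoeff k (map_coef f p : {malg R[nat]}) = f (mcoeff k (p : {malg R[nat]})).
Proof. by rewrite mcoeffE; case: msuppP => //; rewrite raddf0. Qed.

Lemma map_coefB (f : {additive R -> R}) (p q : polyx R) :
  map_coef f (p - q) = map_coef f p - map_coef f q.
Proof.
apply/malgP => k.
by rewrite mcoeffB !map_coefE -raddfB -mcoeffB.
Qed.

Lemma quot_map_pi (f : {additive R -> R}) (p : polyx R) :
  quot_map f (polyx_pi n p) = polyx_pi n (map_coef f p).
Proof.
apply/polyx_piP; rewrite -map_coefB; apply/xn_predP => i lt_in.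
rewrite map_coefE.
have /polyx_piP/xn_predP-> // : polyx_pi n (polyx_repr (polyx_pi n p)) = polyx_pi n p.
  exact: polyx_reprK.
exact: raddf0.
Qed.

Lemma quot_map_zmod (f : {additive R -> R}) : zmod_morphism (quot_map f).
Proof.
move=> u v; rewrite -[u]polyx_reprK -[v]polyx_reprK -polyx_piB.
by rewrite !quot_map_pi map_coefB polyx_piB.
Qed.

Variable qd : quasi_derivation R.

Lemma map_coefM (p q : polyx R) :
  map_coef (qd_delta qd) (p * q) =
  map_coef (qd_sigma qd) p * map_coef (qd_delta qd) q
  + map_coef (qd_delta qd) p * q.
Proof.
apply/malgP => k; rewrite mcoeffD map_coefE !px_mul_coef raddf_sum -big_split.
by apply: eq_bigr => i _; rewrite /= qd_deltaM !map_coefE.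
Qed.

Lemma map_coef_sigmaM (p q : polyx R) :
  map_coef (qd_sigma qd) (p * q) =
  map_coef (qd_sigma qd) p * map_coef (qd_sigma qd) q.
Proof.
apply/malgP => k; rewrite map_coefE !px_mul_coef raddf_sum.
by apply: eq_bigr => i _; rewrite /= rmorphM !map_coefE.
Qed.

Lemma map_coef_sigma1 : map_coef (qd_sigma qd) 1 = 1.
Proof.
apply/malgP => k; rewrite map_coefE !mcoeffU.
by rewrite raddfMn; congr (_ *+ _); exact: rmorph1.
Qed.

Definition sigma_bar : polyx_quot R n -> polyx_quot R n :=
  quot_map (qd_sigma qd).
Definition delta_bar : polyx_quot R n -> polyx_quot R n :=
  quot_map (qd_delta qd).

Lemma sigma_bar_monoid : monoid_morphism sigma_bar.
Proof.
split; first by rewrite /sigma_bar quot_map_pi map_coef_sigma1.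
move=> u v; rewrite -[u]polyx_reprK -[v]polyx_reprK -polyx_piM.
by rewrite /sigma_bar !quot_map_pi map_coef_sigmaM polyx_piM.
Qed.

HB.instance Definition _ := GRing.isZmodMorphism.Build _ _ sigma_bar
  (quot_map_zmod (qd_sigma qd)).
HB.instance Definition _ := GRing.isMonoidMorphism.Build _ _ sigma_bar
  sigma_bar_monoid.
HB.instance Definition _ := GRing.isZmodMorphism.Build _ _ delta_bar
  (quot_map_zmod (qd_delta qd)).

Lemma delta_barM (u v : polyx_quot R n) :
  delta_bar (u * v) = sigma_bar u * delta_bar v + delta_bar u * v.
Proof.
rewrite -[u]polyx_reprK -[v]polyx_reprK -polyx_piM /sigma_bar /delta_bar.
by rewrite !quot_map_pi map_coefM polyx_piD !polyx_piM.
Qed.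

Definition qd_bar : quasi_derivation (polyx_quot R n) :=
  @QuasiDerivation _ sigma_bar delta_bar delta_barM.

End CoefficientMaps.

(* Main.v *)
(** Reading off coefficients of x turns an equation m(y) g(y) = 0 over the
truncated polynomials into the equations sum_(s <= k) m_s(y) g_(k-s)(y) = 0
for k < n.  If g_k is the lowest nonzero coefficient of g, then m_0 g_k = 0,
so m_0 a = 0 for some nonzero a, and a x^(n-1) annihilates m because it only
meets m_0.  Conversely, embed M and R in degree 0 in x: any nonzero
x-coefficient of an annihilator of m in the quotient annihilates m. *)

Require Import Defs.
From HB Require Import structures.
From mathcomp Require Import all_boot all_algebra finmap.
From mathcomp Require Import monalg zify.

Set Implicit Arguments.
Unset Strict Implicit.
Unset Printing Implicit Defensive.

Import GRing.Theory.
Local Open Scope ring_scope.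

(** * Supports and vanishing for the Ore action *)

Section OreAction.
Variables (R : pzRingType) (qd : quasi_derivation R) (M : lmodType R^c).
Implicit Types (m : {malg M[nat]}) (g : {malg R[nat]}).

Lemma qd_f0 i j : qd_f qd i j 0 = 0.
Proof.
rewrite /qd_f big1 // => w _.
by elim: (val w) => //= -[] s ->; rewrite raddf0.
Qed.

Lemma big_msupp_widen (G V : zmodType) (p : {malg G[nat]}) (S : {fset nat})
    (F : nat -> V) :
  (msupp p `<=` S)%fset -> (forall j, p@_j = 0 -> F j = 0) ->
  \sum_(j <- msupp p) F j = \sum_(j <- S) F j.
Proof.
move=> sub F0; apply: (big_fset_incl _ sub) => j _ /mcoeff_outdom.
exact: F0.
Qed.

(** Indices outside the supports contribute zero. This gives Ore products with different supports
    common index sets, so that their sums can be exchanged. *)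
Lemma ore_act_widen (S T : {fset nat}) m g :
  (msupp m `<=` S)%fset -> (msupp g `<=` T)%fset ->
  ore_act qd m g = \sum_(j <- S) \sum_(l <- T) \sum_(i < j.+1)
    << ract m@_j (qd_f qd i j g@_l) *g (i + l)%N >>.
Proof.
move=> subS subT; rewrite /ore_act (big_msupp_widen subS).
  apply: eq_bigr => j _; rewrite (big_msupp_widen subT) // => l ->.
  by rewrite big1 // => i _; rewrite qd_f0 ractm0 monalgU0.
move=> j ->; rewrite big1 // => l _; rewrite big1 // => i _.
by rewrite ract0m monalgU0.
Qed.

Lemma ore_act0m g : ore_act qd (0 : {malg M[nat]}) g = 0.
Proof. by rewrite /ore_act msupp0 big_seq_fset0. Qed.

Lemma ore_actm0 m : ore_act qd m 0 = 0.
Proof. by rewrite /ore_act msupp0 big1 // => j _; rewrite big_seq_fset0. Qed.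

End OreAction.

(** * Maps applied to each coefficient in y *)

Section MapMalg.
Variables (G H : zmodType) (f : G -> H).

(** [f] is a bare function because the intended maps [xcoef k] and [xcoefM k] are shown to be
    additive only for [k < n]. *)
Definition map_malg (p : {malg G[nat]}) : {malg H[nat]} :=
  [malg j in msupp p => f p@_j].

Lemma msupp_map_malg p : (msupp (map_malg p) `<=` msupp p)%fset.
Proof.
apply/fsubsetP => j; apply: contraLR => jN.
by rewrite -mcoeff_eq0 mcoeffE (negPf jN).
Qed.

Hypothesis f0 : f 0 = 0.

Lemma map_malgE p j : (map_malg p)@_j = f p@_j.
Proof. by rewrite mcoeffE; case: msuppP. Qed.

Lemma map_malgU a j : map_malg << a *g j >> = << f a *g j >>.
Proof.
apply/malgP => k; rewrite map_malgE !mcoeffU.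
by case: (j == k); rewrite ?mulr1n ?mulr0n.
Qed.

Lemma map_malg0 : map_malg 0 = 0.
Proof. by apply/malgP => k; rewrite map_malgE !mcoeff0. Qed.

End MapMalg.

(** * Coefficients in x of truncated polynomials, and the transfer in both directions *)

Section TruncatedCoefficients.
Variables (R : pzRingType) (M : lmodType R^c) (n : nat).

(** Read off the chosen representative. Two representatives differ by a multiple of x^n, so the
    value is canonical for [k < n], the only range in which it is used. *)
Definition xcoef k (u : polyx_quot R n) : R :=
  mcoeff k (polyx_repr u : {malg R[nat]}).
Definition xcoefM k (v : polyxM_quot M n) : M :=
  mcoeff k (polyxM_repr v : {malg M[nat]}).

Lemma xcoef_pi k (p : polyx R) :
  (k < n)%N -> xcoef k (polyx_pi n p) = mcoeff k (p : {malg R[nat]}).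
Proof.
move=> lt_kn; apply/eqP; rewrite -subr_eq0 -mcoeffB; apply/eqP.
by apply/xn_predP: k lt_kn; apply/polyx_piP; rewrite polyx_reprK.
Qed.

Lemma xcoefM_pi k (m : polyxM M) :
  (k < n)%N -> xcoefM k (polyxM_pi n m) = mcoeff k (m : {malg M[nat]}).
Proof.
move=> lt_kn; apply/eqP; rewrite -subr_eq0 -mcoeffB; apply/eqP.
by apply/xn_predP: k lt_kn; apply/polyxM_piP; rewrite polyxM_reprK.
Qed.

Lemma xcoefD k : (k < n)%N -> {morph xcoef k : u v / u + v}.
Proof.
move=> lt_kn u v; rewrite -[in LHS](polyx_reprK u) -[in LHS](polyx_reprK v).
by rewrite -polyx_piD xcoef_pi // mcoeffD.
Qed.

Lemma xcoefMD k : (k < n)%N -> {morph xcoefM k : u v / u + v}.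
Proof.
move=> lt_kn u v; rewrite -[in LHS](polyxM_reprK u) -[in LHS](polyxM_reprK v).
by rewrite -polyxM_piD xcoefM_pi // mcoeffD.
Qed.

Lemma xcoef0 k : (k < n)%N -> xcoef k 0 = 0.
Proof. by move=> lt_kn; apply: (addIr (xcoef k 0)); rewrite -xcoefD // !add0r. Qed.

Lemma xcoefM0 k : (k < n)%N -> xcoefM k 0 = 0.
Proof. by move=> lt_kn; apply: (addIr (xcoefM k 0)); rewrite -xcoefMD // !add0r. Qed.

Lemma xcoef_eq0 u : (forall k, (k < n)%N -> xcoef k u = 0) -> u = 0.
Proof.
move=> u0; rewrite -[u]polyx_reprK -[RHS]polyx_reprK.
apply/polyx_piP/xn_predP => i lt_in.
by rewrite mcoeffB [X in X - _](u0 i lt_in) [X in _ - X](xcoef0 lt_in) subr0.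
Qed.

Lemma xcoefM_eq0 v : (forall k, (k < n)%N -> xcoefM k v = 0) -> v = 0.
Proof.
move=> v0; rewrite -[v]polyxM_reprK -[RHS]polyxM_reprK.
apply/polyxM_piP/xn_predP => i lt_in.
by rewrite mcoeffB [X in X - _](v0 i lt_in) [X in _ - X](xcoefM0 lt_in) subr0.
Qed.

Lemma xcoef_neq0 u : u != 0 -> exists2 k, (k < n)%N & xcoef k u != 0.
Proof.
move=> u_n0; case: (boolP [exists k : 'I_n, xcoef k u != 0]).
  by case/existsP=> k; exists k.
rewrite negb_exists => /forallP u0; case/eqP: u_n0; apply: xcoef_eq0 => k lt_kn.
by apply/eqP; move: (u0 (Ordinal lt_kn)); rewrite negbK.
Qed.

Lemma xcoefM_ract k v u : (k < n)%N ->
  xcoefM k (ract v u) = \sum_(s < k.+1) ract (xcoefM s v) (xcoef (k - s)%N u).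
Proof.
(* The quotient action is by definition the class of the action on representatives, so the left side
   unfolds by conversion. *)
by move=> lt_kn; rewrite [LHS](xcoefM_pi _ lt_kn) px_act_coef big_mkord.
Qed.

Variable qd : quasi_derivation R.

Lemma xcoef_qd_f i j k u :
  (k < n)%N -> xcoef k (qd_f (qd_bar n qd) i j u) = qd_f qd i j (xcoef k u).
Proof.
move=> lt_kn; rewrite /qd_f.
rewrite (big_morph _ (xcoefD lt_kn) (xcoef0 lt_kn)); apply: eq_bigr => w _.
elim: (val w) => //= -[] s <-.
  by rewrite /sigma_bar [LHS]xcoef_pi // map_coefE.
by rewrite /delta_bar [LHS]xcoef_pi // map_coefE.
Qed.

(** The Cauchy product in x commutes with the Ore action in y, because every word in the induced
    maps acts on each x-coefficient separately ([xcoef_qd_f]). *)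
Lemma ore_act_xcoef k (m : {malg (polyxM_quot M n)[nat]})
    (g : {malg (polyx_quot R n)[nat]}) : (k < n)%N ->
  map_malg (xcoefM k) (ore_act (qd_bar n qd) m g) =
  \sum_(s < k.+1)
    ore_act qd (map_malg (xcoefM s) m) (map_malg (xcoef (k - s)%N) g).
Proof.
move=> lt_kn; have c0 := xcoefM0 lt_kn.
have mapD : {morph map_malg (xcoefM k) : p q / p + q}.
  by move=> p q; apply/malgP => d; rewrite mcoeffD !map_malgE // mcoeffD xcoefMD.
have map0 := map_malg0 c0.
(* The supports of [m] and [g] contain those of all their x-coefficients, so they serve as index
   sets for every [s]. *)
under [RHS]eq_bigr => s _ do
  rewrite (ore_act_widen qd (msupp_map_malg _ _) (msupp_map_malg _ _)).
rewrite (big_morph _ mapD map0) exchange_big /=; apply: eq_bigr => j _.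
rewrite (big_morph _ mapD map0) exchange_big /=; apply: eq_bigr => l _.
rewrite (big_morph _ mapD map0) exchange_big /=; apply: eq_bigr => i _.
rewrite map_malgU // xcoefM_ract // raddf_sum; apply: eq_bigr => s _ /=.
have lt_sn : (s < n)%N by apply: leq_ltn_trans lt_kn; rewrite -ltnS.
have lt_ksn : (k - s < n)%N by apply: leq_ltn_trans lt_kn; apply: leq_subr.
by rewrite xcoef_qd_f // !map_malgE ?xcoefM0 ?xcoef0.
Qed.

Lemma map_xcoefM_eq0 (m : {malg (polyxM_quot M n)[nat]}) :
  (forall k, (k < n)%N -> map_malg (xcoefM k) m = 0) -> m = 0.
Proof.
move=> m0; apply/malgP => j; rewrite mcoeff0; apply: xcoefM_eq0 => k lt_kn.
by rewrite -map_malgE ?xcoefM0 // m0 // mcoeff0.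
Qed.

Lemma map_xcoef_neq0 (g : {malg (polyx_quot R n)[nat]}) : g != 0 ->
  exists k, (k < n)%N && (map_malg (xcoef k) g != 0).
Proof.
move=> g_n0; have [g0|[j]] := fset_0Vmem (msupp g).
  by case/eqP: g_n0; apply/malgP => j; rewrite mcoeff0 mcoeff_outdom // g0.
rewrite -mcoeff_neq0 => /xcoef_neq0[k lt_kn gjk]; exists k; rewrite lt_kn.
by apply: contraNneq gjk => gk0; rewrite -map_malgE ?xcoef0 // gk0 mcoeff0.
Qed.

Lemma skew_mccoy_quot :
  (0 < n)%N -> skew_mccoy qd M -> skew_mccoy (qd_bar n qd) (polyxM_quot M n).
Proof.
move=> n_gt0 mcM m g g_n0 mg0.
have [k /andP[lt_kn gk_n0] k_min] := ex_minnP (map_xcoef_neq0 g_n0).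
have [|a a_n0 m0a0] := mcM (map_malg (xcoefM 0) m) _ gk_n0.
  have := ore_act_xcoef m g lt_kn.
  (* Only the term pairing x-degree 0 of [m] with [k] survives: the others involve x-coefficients of
     [g] below the minimal [k]. *)
  rewrite mg0 map_malg0 ?xcoefM0 // big_ord_recl subn0 big1 ?addr0 // => s _.
  rewrite [X in ore_act _ _ X](_ : _ = 0) ?ore_actm0 //.
  apply/eqP; apply: contraT => gs_n0.
  have /k_min : (k - lift ord0 s < n)%N
      && (map_malg (xcoef (k - lift ord0 s)%N) g != 0).
    by rewrite gs_n0 (leq_ltn_trans (leq_subr _ _) lt_kn).
  by rewrite leqNgt /= /bump ltn_subrL (leq_trans _ (ltn_ord s)).
have lt_n1 : (n.-1 < n)%N by rewrite prednK.
exists (polyx_pi n << a *g n.-1 >>).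
  apply: contra_neq a_n0 => /(congr1 (xcoef n.-1)).
  by rewrite xcoef_pi // xcoef0 // mcoeffUU.
apply: map_xcoefM_eq0 => t lt_tn; rewrite ore_act_xcoef //.
rewrite big1 // => s _.
have lt_tsn : (t - s < n)%N by apply: leq_ltn_trans lt_tn; apply: leq_subr.
(* The witness has x-degree n-1, so a term can be nonzero only if t - s = n-1; as t < n, this forces
   s = 0, where [m0a0] applies. *)
rewrite map_malgU ?xcoef0 // xcoef_pi // mcoeffU.
case: eqP => [n1E|_]; last by rewrite mulr0n monalgU0 ore_actm0.
suff -> : s = ord0 by rewrite mulr1n.
apply/val_inj => /=; have := ltn_ord s; lia.
Qed.

Lemma skew_mccoy_of_quot :
  (0 < n)%N -> skew_mccoy (qd_bar n qd) (polyxM_quot M n) -> skew_mccoy qd M.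
Proof.
move=> n_gt0 mcQ m g g_n0 mg0.
pose iota (b : R) := polyx_pi n << b *g 0%N >>.
pose iotaM (b : M) := polyxM_pi n << b *g 0%N >>.
have iota0 : iota 0 = 0.
  by apply: xcoef_eq0 => k lt_kn; rewrite xcoef_pi // monalgU0 mcoeff0.
have iotaM0 : iotaM 0 = 0.
  by apply: xcoefM_eq0 => k lt_kn; rewrite xcoefM_pi // monalgU0 mcoeff0.
have iotaE k : (k < n)%N ->
    map_malg (xcoef k) (map_malg iota g) = if k == 0%N then g else 0.
  move=> lt_kn; apply/malgP => j; rewrite !map_malgE ?xcoef0 // xcoef_pi //.
  by rewrite mcoeffU eq_sym; case: eqP; rewrite ?mcoeff0.
have iotaME k : (k < n)%N ->
    map_malg (xcoefM k) (map_malg iotaM m) = if k == 0%N then m else 0.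
  move=> lt_kn; apply/malgP => j; rewrite !map_malgE ?xcoefM0 // xcoefM_pi //.
  by rewrite mcoeffU eq_sym; case: eqP; rewrite ?mcoeff0.
(* The embedded [m] lives in x-degree 0, so it multiplies each x-coefficient of [h] separately. This
   serves both for the embedded [g] and for the annihilator [u]. *)
have mulE k h : (k < n)%N ->
    map_malg (xcoefM k) (ore_act (qd_bar n qd) (map_malg iotaM m) h) =
    ore_act qd m (map_malg (xcoef k) h).
  move=> lt_kn; rewrite ore_act_xcoef // big_ord_recl iotaME // subn0.
  rewrite big1 ?addr0 // => s _.
  by rewrite iotaME ?ore_act0m // (leq_ltn_trans _ lt_kn) // ltn_ord.
have [||u u_n0 mu0] := mcQ (map_malg iotaM m) (map_malg iota g).
- apply: contra_neq g_n0 => /(congr1 (map_malg (xcoef 0))).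
  by rewrite iotaE // map_malg0 // xcoef0.
- apply: map_xcoefM_eq0 => k lt_kn; rewrite mulE // iotaE //.
  by case: eqP => // _; rewrite ore_actm0.
have [k lt_kn uk_n0] := xcoef_neq0 u_n0.
exists (xcoef k u) => //.
by rewrite -map_malgU ?xcoef0 // -mulE // mu0 map_malg0 // xcoefM0.
Qed.

Lemma skew_mccoy_quotP : (0 < n)%N ->
  skew_mccoy qd M <-> skew_mccoy (qd_bar n qd) (polyxM_quot M n).
Proof.
by move=> n_gt0; split; [apply: skew_mccoy_quot | apply: skew_mccoy_of_quot].
Qed.

End TruncatedCoefficients.

(** * The regular module and the McCoy case *)

Lemma skew_mccoy_ring_quotP (R : pzRingType) (qd : quasi_derivation R) n :
  (0 < n)%N -> skew_mccoy_ring qd <-> skew_mccoy_ring (qd_bar n qd).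
Proof.
(* The two module structures on R[x]/(x^n), as the quotient of the module
   (R_R)[x] and as the regular module, are convertible. *)
exact: (@skew_mccoy_quotP R (R^c)^o n qd).
Qed.

(** Pointwise agreement is what is available for [qd_bar n (qd_id R)] and [qd_id (polyx_quot R n)]:
    the former is computed through representatives. *)
Lemma eq_skew_mccoy (R : pzRingType) (qd qd' : quasi_derivation R)
    (M : lmodType R^c) :
  qd_sigma qd =1 qd_sigma qd' -> qd_delta qd =1 qd_delta qd' ->
  skew_mccoy qd M -> skew_mccoy qd' M.
Proof.
move=> eq_sigma eq_delta mcM m g g_n0.
have eq_f i j a : qd_f qd i j a = qd_f qd' i j a.
  apply: eq_bigr => w _; elim: (val w) => //= -[] s ->.
    exact: eq_sigma.
  exact: eq_delta.
have eq_act h : ore_act qd m h = ore_act qd' m h.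
  apply: eq_bigr => j _; apply: eq_bigr => l _; apply: eq_bigr => i _.
  by rewrite eq_f.
rewrite -eq_act => /(mcM _ _ g_n0)[a a_n0 ma0].
by exists a; rewrite // -eq_act.
Qed.

Lemma mccoy_ring_quotP (R : pzRingType) n :
  (0 < n)%N -> mccoy_ring R <-> mccoy_ring (polyx_quot R n).
Proof.
move=> n_gt0; rewrite /mccoy_ring (skew_mccoy_ring_quotP (qd_id R) n_gt0).
have eq_sigma : qd_sigma (qd_bar n (qd_id R)) =1 qd_sigma (qd_id (polyx_quot R n)).
  (* Applying the identity to each coefficient rebuilds the representative of [u], whose class is
     [u] again. *)
  move=> u; rewrite -[RHS]polyx_reprK; congr polyx_pi.
  by apply/malgP => k; rewrite (map_coefE (qd_sigma (qd_id R))).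
have eq_delta : qd_delta (qd_bar n (qd_id R)) =1 qd_delta (qd_id (polyx_quot R n)).
  move=> u; apply: xcoef_eq0 => k lt_kn.
  by rewrite [LHS]xcoef_pi // (map_coefE (qd_delta (qd_id R))).
by split; apply: eq_skew_mccoy.
Qed.

Theorem corollary3p3 (R : pzRingType) (qd : quasi_derivation R)
    (M : lmodType R^c) (n : nat) (hn : (2 <= n)%N) :
  [/\ skew_mccoy qd M <-> skew_mccoy (qd_bar n qd) (polyxM_quot M n),
      skew_mccoy_ring qd <-> skew_mccoy_ring (qd_bar n qd)
    & mccoy_ring R <-> mccoy_ring (polyx_quot R n)].
Proof.
have n_gt0 : (0 < n)%N by apply: ltnW.
by split; [apply: skew_mccoy_quotP | apply: skew_mccoy_ring_quotP
          | apply: mccoy_ring_quotP].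
Qed.
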